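(* Let $\tilde A_i=(a_i;\,l_i^{\mu L},r_i^{\mu L},l_i^{\mu U},r_i^{\mu U};\,l_i^{\nu L},r_i^{\nu L},l_i^{\nu U},r_i^{\nu U})_{LR}$, $i=1,2$, be $LR$-type IVIFNs with the same shape functions, where $a_1-l_1^{\nu U}<0$ and $a_1-l_1^{\mu U}\ge0$, and $\tilde A_2$ is arbitrary. Then $\tilde A_1\odot\tilde A_2=(a;\,l^{\mu L},r^{\mu L},l^{\mu U},r^{\mu U};\,l^{\nu L},r^{\nu L},l^{\nu U},r^{\nu U})_{LR}$, where $a=a_1a_2$; for each $\kappa\in\{\mu L,\mu U\}$, $$l^\kappa=a_1a_2-\min\{(a_1+r_1^\kappa)(a_2-l_2^\kappa),(a_1-l_1^\kappa)(a_2-l_2^\kappa)\},\quad r^\kappa=\max\{(a_1+r_1^\kappa)(a_2+r_2^\kappa),(a_1-l_1^\kappa)(a_2+r_2^\kappa)\}-a_1a_2;$$ and for each $\kappa\in\{\nu L,\nu U\}$, $$l^\kappa=a_1a_2-\min\{(a_1-l_1^\kappa)(a_2+r_2^\kappa),(a_1+r_1^\kappa)(a_2-l_2^\kappa)\},\quad r^\kappa=\max\{(a_1+r_1^\kappa)(a_2+r_2^\kappa),(a_1-l_1^\kappa)(a_2-l_2^\kappa)\}-a_1a_2.$$ Moreover the conditions for an $LR$-type representation hold: all eight spreads of the product are positive and $l^{\mu U}\ge l^{\mu L}$, $l^{\nu L}\ge l^{\nu U}$, $l^{\nu L}\ge l^{\mu L}$, $l^{\nu U}\ge l^{\mu U}$,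 and likewise with $r$ in place of $l$.
   Context: A shape function is a continuous, strictly decreasing, invertible $f:[0,\infty)\to[0,1]$ with $f(0)=1$ and $\lim_{x\to\infty}f(x)=0$. Fix shape functions $L,R,L',R'$. An $LR$-type interval-valued intuitionistic fuzzy number (IVIFN) is written $\tilde A=(a;l^{\mu L},r^{\mu L},l^{\mu U},r^{\mu U};l^{\nu L},r^{\nu L},l^{\nu U},r^{\nu U})_{LR}$, where $a\in\mathbb R$ is its mean value and the eight spreads are positive reals with $l^{\mu U}\ge l^{\mu L}$, $r^{\mu U}\ge r^{\mu L}$, $l^{\nu L}\ge l^{\nu U}$, $r^{\nu L}\ge r^{\nu U}$, $l^{\nu L}\ge l^{\mu L}$, $r^{\nu L}\ge r^{\mu L}$, $l^{\nu U}\ge l^{\mu U}$, $r^{\nu U}\ge r^{\mu U}$. It encodes a lower membership function equal to $L((a-x)/l^{\mu L})$ on $[a-l^{\mu L},a]$, $R((x-a)/r^{\mu L})$ on $[a,a+r^{\mu L}]$, and $0$ otherwise; an upper membership function of the same form with $L',R',l^{\mu U},r^{\mu U}$; a lower non-membership function equal to $1-L((a-x)/l^{\nu L})$ on $[a-l^{\nu L},a]$, $1-R((x-a)/r^{\nu L})$ on $[a,a+r^{\nu L}]$, and $1$ otherwise; and an upper non-membership function of the same form with $L',R',l^{\nu U},r^{\nu U}$. At each $x$ the supremum of the membership interval plus the supremum of the non-membership interval is at most $1$. The product $\tilde A_1\odot\tilde A_2$ is formed cutwise by interval multiplication and read off at the level where the inverse shape functions equal $0$ (giving the mean) and at the level where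 they equal $1$ (giving the spreads). That is, it is the tuple (with the same shape functions) with mean $a=a_1a_2$ and spreads determined, for each $\kappa\in\{\mu L,\mu U,\nu L,\nu U\}$, by $$[a-l^{\kappa},a+r^{\kappa}]=[a_1-l_1^{\kappa},a_1+r_1^{\kappa}]\times[a_2-l_2^{\kappa},a_2+r_2^{\kappa}],$$ where $I\times J=\{xy:x\in I,y\in J\}$. *)

(* Defs.v *)
From HB Require Import structures.
From mathcomp Require Import all_boot all_order all_algebra.
From mathcomp Require Import all_classical all_reals all_analysis.

Set Implicit Arguments.
Unset Strict Implicit.
Unset Printing Implicit Defensive.

Import Order.TTheory GRing.Theory Num.Theory.
Import numFieldNormedType.Exports.

Local Open Scope classical_set_scope.
Local Open Scope ring_scope.

(* Only the values of [f] on [0, +oo[ matter.  A strictly decreasing [f] with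
   limit 0 never takes the value 0, so "invertible" cannot mean bijective onto
   [0, 1]: it means bijective onto the image ]0, 1]. *)
Record shape_function (K : realType) (f : K -> K) : Prop := ShapeFunction {
  shape_continuous : {within `[0, +oo[, continuous f};
  shape_range : forall x, 0 <= x -> 0 <= f x <= 1;
  shape_decreasing : forall x y, 0 <= x -> x < y -> f y < f x;
  shape_invertible : set_bij `[0, +oo[ `]0, 1] f;
  shape0 : f 0 = 1;
  shape_lim : f x @[x --> +oo] --> (0 : K)
}.

(* [mu] is membership, [nu] non-membership; [L] is lower, [U] upper. *)
Inductive grade := muL | muU | nuL | nuU.

Record lr_tuple (K : realType) := LRTuple {
  mean : K;
  lspread : grade -> K;
  rspread : grade -> K
}.

Section IVIFN.
Variable K : realType.
Implicit Types (A : lr_tuple K) (k : grade).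

(* The two branches overlap only at [x = a], where both equal 1. *)
Definition lr_bell (f g : K -> K) (a l r x : K) : K :=
  if a - l <= x <= a then f ((a - x) / l)
  else if a <= x <= a + r then g ((x - a) / r)
  else 0.

Definition lower_membership (L R : K -> K) A (x : K) : K :=
  lr_bell L R (mean A) (lspread A muL) (rspread A muL) x.

Definition upper_membership (L' R' : K -> K) A (x : K) : K :=
  lr_bell L' R' (mean A) (lspread A muU) (rspread A muU) x.

Definition lower_nonmembership (L R : K -> K) A (x : K) : K :=
  1 - lr_bell L R (mean A) (lspread A nuL) (rspread A nuL) x.

Definition upper_nonmembership (L' R' : K -> K) A (x : K) : K :=
  1 - lr_bell L' R' (mean A) (lspread A nuU) (rspread A nuU) x.

Definition spreads_ordered (s : grade -> K) : Prop :=
  [/\ s muL <= s muU, s nuU <= s nuL, s muL <= s nuL & s muU <= s nuU].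

Definition membership_interval (L R L' R' : K -> K) A (x : K) : set K :=
  `[lower_membership L R A x, upper_membership L' R' A x].

Definition nonmembership_interval (L R L' R' : K -> K) A (x : K) : set K :=
  `[lower_nonmembership L R A x, upper_nonmembership L' R' A x].

(* The order of the spreads does not relate [L] to [L'] or [R] to [R'], so the
   two intervals are not required to be nonempty; [sup set0 = 0]. *)
Record lr_ivifn (L R L' R' : K -> K) A : Prop := LRIVIFN {
  lspread_gt0 : forall k, 0 < lspread A k;
  rspread_gt0 : forall k, 0 < rspread A k;
  lspread_ordered : spreads_ordered (lspread A);
  rspread_ordered : spreads_ordered (rspread A);
  sup_sum_le1 : forall x,
    sup (membership_interval L R L' R' A x) +
    sup (nonmembership_interval L R L' R' A x) <= 1
}.

Definition lr_interval A k : set K :=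
  `[mean A - lspread A k, mean A + rspread A k].

(* [A] is the product of [A1] and [A2]. *)
Definition lr_product A1 A2 A : Prop :=
  mean A = mean A1 * mean A2 /\
  forall k, lr_interval A k =
    [set x * y | x in lr_interval A1 k & y in lr_interval A2 k].

End IVIFN.

(* Main.v *)
(* The product of two compact intervals is an interval, by the intermediate value
   theorem along a segment of the rectangle; its endpoints are products of
   endpoints.  As the mean of the first factor is positive, the product interval
   contains points on both sides of the mean [a1 * a2], and nested factors have
   nested products: positivity and the order of the spreads follow from the
   product equation alone. *)
Require Import Defs.
From HB Require Import structures.
From mathcomp Require Import all_boot all_order all_algebra.
From mathcomp Require Import all_classical all_reals all_analysis.
From mathcomp Require Import lra.

Set Implicit Arguments.
Unset Strict Implicit.
Unset Printing Implicit Defensive.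

Import Order.TTheory GRing.Theory Num.Theory.
Import numFieldNormedType.Exports.

Local Open Scope classical_set_scope.
Local Open Scope ring_scope.

Section IntervalProducts.
Variable K : realType.
Implicit Types (a b c d u v z : K).

Lemma itv_mul_connected a b c d u v z :
  [set x * y | x in `[a, b] & y in `[c, d]] u ->
  [set x * y | x in `[a, b] & y in `[c, d]] v -> u <= z <= v ->
  [set x * y | x in `[a, b] & y in `[c, d]] z.
Proof.
move=> [x0 x0X [y0 y0Y <-]] [x1 x1X [y1 y1Y <-]] /andP[uz zv].
(* The product of the coordinates along the segment from [(x0, y0)] to [(x1, y1)], which stays
   inside the rectangle by convexity. *)
pose f t : K := (x0 + t * (x1 - x0)) * (y0 + t * (y1 - y0)).
have f0 : f 0 = x0 * y0 by rewrite /f !mul0r !addr0.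
have f1 : f 1 = x1 * y1 by rewrite /f !mul1r !subrKC.
have cf : {within `[0, 1], continuous f}.
  apply: continuous_subspaceT => x.
  by apply: cvgM; apply: cvgD; (try exact: cvg_cst);
    apply: cvgM; [exact: cvg_id|exact: cvg_cst|exact: cvg_id|exact: cvg_cst].
have z01 : Num.min (f 0) (f 1) <= z <= Num.max (f 0) (f 1).
  by rewrite f0 f1 ge_min uz le_max zv orbT.
have [t + <-] := IVT ler01 cf z01.
rewrite in_itv /= => /andP[t0 t1].
move: x0X x1X y0Y y1Y; rewrite /= !in_itv /=.
move=> /andP[? ?] /andP[? ?] /andP[? ?] /andP[? ?].
exists (x0 + t * (x1 - x0)); first by rewrite /= in_itv /=; apply/andP; split; nra.
by exists (y0 + t * (y1 - y0)) => //; rewrite /= in_itv /=; apply/andP; split; nra.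
Qed.

Lemma itv_mulE a b c d u v :
  [set x * y | x in `[a, b] & y in `[c, d]] u ->
  [set x * y | x in `[a, b] & y in `[c, d]] v ->
  (forall x y, a <= x <= b -> c <= y <= d -> u <= x * y <= v) ->
  `[u, v]%classic = [set x * y | x in `[a, b] & y in `[c, d]].
Proof.
move=> Pu Pv bnd; apply/seteqP; split=> [z|_ [x + [y + <-]]] /=; rewrite !in_itv /=.
  exact: itv_mul_connected.
exact: bnd.
Qed.

Lemma itvcc_subset_le a b c d : a <= b ->
  `[a, b]%classic `<=` `[c, d]%classic -> c <= a /\ b <= d.
Proof.
move=> ab sub; have /sub : `[a, b]%classic a by rewrite /= in_itv /= lexx.
have /sub : `[a, b]%classic b by rewrite /= in_itv /= lexx andbT.
by rewrite /= !in_itv /= => /andP[_ ->] /andP[-> _].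
Qed.

(** Inclusion determines endpoints only for a nonempty interval; that [[c, d]] is nonempty follows
    from [c <= a <= b <= d]. *)
Lemma itvcc_inj a b c d : a <= b ->
  `[a, b]%classic = `[c, d]%classic -> a = c /\ b = d.
Proof.
move=> ab E; have [ca bd] : c <= a /\ b <= d by apply: itvcc_subset_le; rewrite ?E.
have [ac db] : a <= c /\ d <= b.
  by apply: itvcc_subset_le; rewrite ?E//; exact: le_trans ca (le_trans ab bd).
by split; apply/le_anti/andP.
Qed.

(** For [x >= 0] the product [x * y] is nondecreasing in [y], so it lies between [x * c] and
    [x * d]. Each of these is linear in [x], hence extremal at [a] or [b], according to the sign of
    [c] or [d]. *)
Lemma itv_mul_min_max_pos a b c d (m := Num.min (b * c) (a * c))
    (M := Num.max (b * d) (a * d)) : 0 <= a -> a <= b -> c <= d ->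
  `[m, M]%classic = [set x * y | x in `[a, b] & y in `[c, d]].
Proof.
move=> a0 ab cd.
have Xa : `[a, b]%classic a by rewrite /= in_itv /= lexx.
have Xb : `[a, b]%classic b by rewrite /= in_itv /= lexx andbT.
have Yc : `[c, d]%classic c by rewrite /= in_itv /= lexx.
have Yd : `[c, d]%classic d by rewrite /= in_itv /= lexx andbT.
apply: itv_mulE.
- by rewrite /m minEle; case: ifP => _; [exists b|exists a] => //; exists c.
- by rewrite /M maxEle; case: ifP => _; [exists a|exists b] => //; exists d.
move=> x y /andP[ax xb] /andP[cy yd]; rewrite ge_min le_max.
apply/andP; split; apply/orP.
  by have [c0|c0] := leP 0 c; [right|left]; nra.
by have [d0|d0] := leP 0 d; [left|right]; nra.
Qed.

(** Here the sign of [x] decides whether [x * y] grows or falls with [y]. Two corners suffice for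
    each bound: if [x * y] is nonnegative throughout the half considered, then 0 separates it from
    [a * d] or [b * c], and dually for the maximum. *)
Lemma itv_mul_min_max_mixed a b c d (m := Num.min (a * d) (b * c))
    (M := Num.max (b * d) (a * c)) : a <= 0 -> 0 <= b -> c <= d ->
  `[m, M]%classic = [set x * y | x in `[a, b] & y in `[c, d]].
Proof.
move=> a0 b0 cd; have ab := le_trans a0 b0.
have Xa : `[a, b]%classic a by rewrite /= in_itv /= lexx.
have Xb : `[a, b]%classic b by rewrite /= in_itv /= lexx andbT.
have Yc : `[c, d]%classic c by rewrite /= in_itv /= lexx.
have Yd : `[c, d]%classic d by rewrite /= in_itv /= lexx andbT.
apply: itv_mulE.
- by rewrite /m minEle; case: ifP => _; [exists a|exists b] => //; [exists d|exists c].
- by rewrite /M maxEle; case: ifP => _; [exists a|exists b] => //; [exists c|exists d].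
move=> x y /andP[ax xb] /andP[cy yd]; rewrite ge_min le_max.
apply/andP; split; apply/orP; have [x0|x0] := leP 0 x.
- have [c0|c0] := leP 0 c; [left|right]; nra.
- have [d0|d0] := leP 0 d; [left|right]; nra.
- have [d0|d0] := leP 0 d; [left|right]; nra.
- have [c0|c0] := leP 0 c; [left|right]; nra.
Qed.

End IntervalProducts.

Section Bells.
Variable K : realType.
Implicit Types (f g : K -> K) (a l r x u v : K).

Lemma shape_nonincreasing f u v :
  shape_function f -> 0 <= u -> u <= v -> f v <= f u.
Proof.
move=> hf u0; rewrite le_eqVlt => /predU1P[->//|uv].
exact/ltW/(shape_decreasing hf).
Qed.

Lemma lr_bell_ge0_le1 f g a l r x : shape_function f -> shape_function g ->
  0 < l -> 0 < r -> 0 <= lr_bell f g a l r x <= 1.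
Proof.
move=> hf hg l0 r0; rewrite /lr_bell.
case: ifPn => [/andP[_ xa]|_].
  by apply: shape_range => //; rewrite divr_ge0 ?subr_ge0// ltW.
case: ifPn => [/andP[ax _]|_]; last by rewrite lexx ler01.
by apply: shape_range => //; rewrite divr_ge0 ?subr_ge0// ltW.
Qed.

(** A larger spread shrinks the argument of a decreasing shape, which raises its value. Outside the
    narrow support the smaller bell is 0 and the larger one is nonnegative. *)
Lemma le_lr_bell f g a l r l' r' x : shape_function f -> shape_function g ->
  0 < l -> 0 < r -> l <= l' -> r <= r' ->
  lr_bell f g a l r x <= lr_bell f g a l' r' x.
Proof.
move=> hf hg l0 r0 ll rr.
have l'0 := lt_le_trans l0 ll; have r'0 := lt_le_trans r0 rr.
have /andP[bell0 _] := lr_bell_ge0_le1 a x hf hg l'0 r'0.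
rewrite {1}/lr_bell; case: ifPn => [/andP[lx xa]|lxa].
  rewrite /lr_bell xa andbT ifT; last by lra.
  apply: shape_nonincreasing => //; first by rewrite divr_ge0 ?subr_ge0// ltW.
  by rewrite ler_wpM2l ?subr_ge0// lef_pV2.
case: ifPn => // /andP[ax xr].
(* At [x = a] the left branch would have applied, so [x > a] and the wider bell is on its right
   branch too. *)
have xNa : (x <= a) = false by apply/negbTE; move: lxa; rewrite negb_and; lra.
rewrite /lr_bell xNa andbF ax ifT; last by rewrite /=; lra.
apply: shape_nonincreasing => //; first by rewrite divr_ge0 ?subr_ge0// ltW.
by rewrite ler_wpM2l ?subr_ge0// lef_pV2.
Qed.

Lemma sup_itvcc_dichotomy u v : sup `[u, v] = v \/ sup `[u, v] = 0.
Proof.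
have [uv|vu] := leP u v; first by left; rewrite sup_itv//= bnd_simp.
by right; rewrite set_itv_ge ?sup0// bnd_simp -ltNge.
Qed.

(* Membership and non-membership of type U use the same shapes, so the sum
   condition compares bells that differ by their spreads only. *)
Lemma lr_ivifn_of_spreads (L R L' R' : K -> K) (A : lr_tuple K) :
  shape_function L' -> shape_function R' ->
  (forall k, 0 < lspread A k) -> (forall k, 0 < rspread A k) ->
  spreads_ordered (lspread A) -> spreads_ordered (rspread A) ->
  lr_ivifn L R L' R' A.
Proof.
move=> hL hR l0 r0 hl hr; split => // x.
case: (hl) => _ _ _ lU; case: (hr) => _ _ _ rU.
have := le_lr_bell (mean A) x hL hR (l0 muU) (r0 muU) lU rU.
have /andP[] := lr_bell_ge0_le1 (mean A) x hL hR (l0 muU) (r0 muU).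
have /andP[] := lr_bell_ge0_le1 (mean A) x hL hR (l0 nuU) (r0 nuU).
rewrite -/(upper_membership L' R' A x).
set nU := lr_bell L' R' _ (lspread A nuU) _ _.
rewrite /membership_interval /nonmembership_interval.
(* An empty interval has supremum 0. If neither is empty, the sum is at most 1 because the [muU]
   bell lies below the [nuU] bell; in the other cases, because bells take values in [0, 1]. *)
have [->|->] := sup_itvcc_dichotomy (lower_membership L R A x)
    (upper_membership L' R' A x);
  have [->|->] := sup_itvcc_dichotomy (lower_nonmembership L R A x)
    (upper_nonmembership L' R' A x);
  rewrite ?/upper_nonmembership -/nU; lra.
Qed.

End Bells.

Section Products.
Variable K : realType.
Implicit Types A B : lr_tuple K.

Lemma lr_interval_sub A k k' :
  lspread A k <= lspread A k' -> rspread A k <= rspread A k' ->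
  lr_interval A k `<=` lr_interval A k'.
Proof. by move=> ? ? x; rewrite /lr_interval /= !in_itv /= => /andP[? ?]; lra. Qed.

Lemma lr_interval_le A k k' : 0 < lspread A k -> 0 < rspread A k ->
  lr_interval A k `<=` lr_interval A k' ->
  lspread A k <= lspread A k' /\ rspread A k <= rspread A k'.
Proof. by move=> ? ? /itvcc_subset_le[|? ?]; lra. Qed.

(** Positive spreads make the intervals of [A] nonempty, so they fix the endpoints; the common mean
    then fixes the spreads. *)
Lemma lr_product_unique A1 A2 A B :
  (forall k, 0 < lspread A k) -> (forall k, 0 < rspread A k) ->
  lr_product A1 A2 A -> lr_product A1 A2 B -> B = A.
Proof.
move=> l0 r0 [mA iA] [mB iB].
have E k : lspread B k = lspread A k /\ rspread B k = rspread A k.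
  have : lr_interval A k = lr_interval B k by rewrite iA iB.
  move=> /itvcc_inj[]; first by move: (l0 k) (r0 k); lra.
  by rewrite mA mB; lra.
case: A B mA mB E {l0 r0 iA iB} => m l r [m' l' r'] /= -> -> E.
by congr LRTuple; apply/funext => k; case: (E k).
Qed.

Lemma lr_product_spread_gt0 A1 A2 A k : 0 < mean A1 ->
  0 < lspread A1 k -> 0 < rspread A1 k -> 0 < lspread A2 k -> 0 < rspread A2 k ->
  lr_product A1 A2 A -> 0 < lspread A k /\ 0 < rspread A k.
Proof.
move=> m0 l10 r10 l20 r20 [mA iA].
(* Freezing the first factor at its positive mean and taking for [y] the endpoints of the second
   interval gives points strictly on either side of [mean A]. *)
have inA y : lr_interval A2 k y -> lr_interval A k (mean A1 * y).
  move=> Yy; rewrite iA; exists (mean A1); last by exists y.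
  by rewrite /lr_interval /= in_itv /=; lra.
have := inA (mean A2 - lspread A2 k); have := inA (mean A2 + rspread A2 k).
rewrite /lr_interval /= !in_itv /= mA => /(_ ltac:(lra))/andP[_ hr].
by move=> /(_ ltac:(lra))/andP[hl _]; split; nra.
Qed.

Lemma lr_product_spreads_le A1 A2 A k k' :
  lr_product A1 A2 A -> 0 < lspread A k -> 0 < rspread A k ->
  lspread A1 k <= lspread A1 k' -> rspread A1 k <= rspread A1 k' ->
  lspread A2 k <= lspread A2 k' -> rspread A2 k <= rspread A2 k' ->
  lspread A k <= lspread A k' /\ rspread A k <= rspread A k'.
Proof.
move=> [_ iA] l0 r0 l1 r1 l2 r2; apply: lr_interval_le => //.
rewrite !iA => _ [x Xx [y Yy <-]].
exists x; first exact: lr_interval_sub Xx.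
by exists y => //; exact: lr_interval_sub Yy.
Qed.

Lemma lr_product_ivifn (L R L' R' : K -> K) A1 A2 A :
  shape_function L' -> shape_function R' -> 0 < mean A1 ->
  lr_ivifn L R L' R' A1 -> lr_ivifn L R L' R' A2 -> lr_product A1 A2 A ->
  lr_ivifn L R L' R' A.
Proof.
move=> hL hR m0 [l10 r10 ol1 or1 _] [l20 r20 ol2 or2 _] pA.
have s0 k := lr_product_spread_gt0 m0 (l10 k) (r10 k) (l20 k) (r20 k) pA.
have l0 k : 0 < lspread A k by case: (s0 k).
have r0 k : 0 < rspread A k by case: (s0 k).
have le k k' := lr_product_spreads_le (k' := k') pA (l0 k) (r0 k).
case: ol1 or1 ol2 or2 => [? ? ? ?] [? ? ? ?] [? ? ? ?] [? ? ? ?].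
by apply: lr_ivifn_of_spreads => //; split; apply le.
Qed.

End Products.

Theorem proposition3p1p4 (K : realType) (L R L' R' : K -> K)
    (hL : shape_function L) (hR : shape_function R)
    (hL' : shape_function L') (hR' : shape_function R')
    (a1 a2 : K) (l1 r1 l2 r2 : grade -> K)
    (hA1 : lr_ivifn L R L' R' (LRTuple a1 l1 r1))
    (hA2 : lr_ivifn L R L' R' (LRTuple a2 l2 r2))
    (hnu : a1 - l1 nuU < 0) (hmu : 0 <= a1 - l1 muU) :
  let A := LRTuple (a1 * a2)
    (fun k => match k with
      | muL | muU =>
          a1 * a2 - Num.min ((a1 + r1 k) * (a2 - l2 k))
                            ((a1 - l1 k) * (a2 - l2 k))
      | nuL | nuU =>
          a1 * a2 - Num.min ((a1 - l1 k) * (a2 + r2 k))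
                            ((a1 + r1 k) * (a2 - l2 k))
      end)
    (fun k => match k with
      | muL | muU =>
          Num.max ((a1 + r1 k) * (a2 + r2 k))
                  ((a1 - l1 k) * (a2 + r2 k)) - a1 * a2
      | nuL | nuU =>
          Num.max ((a1 + r1 k) * (a2 + r2 k))
                  ((a1 - l1 k) * (a2 - l2 k)) - a1 * a2
      end) in
  (forall B : lr_tuple K,
     lr_product (LRTuple a1 l1 r1) (LRTuple a2 l2 r2) B <-> B = A) /\
  lr_ivifn L R L' R' A.
Proof.
move=> A.
(* [l1 muL <= l1 muU] and [l1 nuU <= l1 nuL] carry the two sign hypotheses over to the lower
   grades. *)
case: (hA1) => /= l10 r10 [? _ _ _] _ _; case: (hA1) => /= _ _ [_ ? _ _] _ _.
case: (hA2) => /= l20 r20 _ _ _.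
have a10 : 0 < a1 by have := l10 muU; lra.
have pA : lr_product (LRTuple a1 l1 r1) (LRTuple a2 l2 r2) A.
  split=> // k; rewrite /lr_interval.
  have := l10 k; have := r10 k; have := l20 k; have := r20 k.
  (* The first interval is nonnegative for the membership grades and contains 0 for the
     non-membership grades. *)
  by case: k => /= ? ? ? ?; rewrite subKr subrKC;
    (apply: itv_mul_min_max_pos || apply: itv_mul_min_max_mixed); lra.
have hA : lr_ivifn L R L' R' A by exact: lr_product_ivifn hA1 hA2 pA.
split=> // B; split=> [|->//].
(* Uniqueness uses the positivity of the spreads of [A], hence comes after [hA]. *)
exact: lr_product_unique (lspread_gt0 hA) (rspread_gt0 hA) pA.
Qed.
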